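(* Adversarial inverse reinforcement learning (AIRL) is an instance of non-adversarial imitation learning (NAIL). That is, at every iteration of AIRL with current policy $\tilde\pi$: the discriminator update is a density-ratio estimation step, in that $\tilde\phi(\mathbf s,\mathbf a)=\exp\big(\bar\nu_{\boldsymbol\theta}(\mathbf s,\mathbf a)-\log\tilde\pi(\mathbf a|\mathbf s)\big)$ is an estimate of $\frac{q(\mathbf s,\mathbf a)}{p^{\tilde\pi}(\mathbf s,\mathbf a)}$ (equal to it when the discriminator is optimal for the binary cross-entropy loss); and the policy objective $J_{\text{AIRL-maxent}}$ optimized by AIRL is the NAIL objective $J_{\mathrm{NAIL},\tilde\pi}$ with the density ratio $\frac{q}{p^{\tilde\pi}}$ replaced by its estimate $\tilde\phi$ (equivalently, with $r_{\mathrm{lb}}^{\tilde\pi}$ estimated by $\bar\nu_{\boldsymbol\theta}$).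
   Context: Setting: a Markov decision process with states $\mathbf s$, actions $\mathbf a$, initial state distribution $p_0(\mathbf s)$, transition dynamics $p(\mathbf s_{t+1}|\mathbf s_t,\mathbf a_t)$ and discount $\gamma<1$. A (stochastic) policy is a conditional distribution $\pi(\mathbf a|\mathbf s)$; $p_t^\pi(\mathbf s,\mathbf a)$ is the induced distribution of state and action at time step $t$, and $p^\pi(\mathbf s,\mathbf a)=(1-\gamma)\sum_{t=0}^\infty\gamma^t p_t^\pi(\mathbf s,\mathbf a)$. $q(\mathbf s,\mathbf a)$ is the expert's state-action distribution. NAIL: starting from an initial policy $\tilde\pi$, repeat until converged: (1) compute an estimate $\tilde\phi(\mathbf s,\mathbf a)$ of $\frac{q(\mathbf s,\mathbf a)}{p^{\tilde\pi}(\mathbf s,\mathbf a)}$ (e.g. from samples of $p^{\tilde\pi}$ and expert demonstrations); (2) replace $\tilde\pi$ by a policy that improves on $$J_{\mathrm{NAIL},\tilde\pi}(\pi)=\int_{\mathbf s,\mathbf a}p^\pi(\mathbf s,\mathbf a)\Big(r_{\mathrm{lb}}^{\tilde\pi}(\mathbf s,\mathbf a)-\log\pi(\mathbf a|\mathbf s)\Big)d\mathbf s\,d\mathbf a,\qquad r_{\mathrm{lb}}^{\tilde\pi}(\mathbf s,\mathbf a)=\log\frac{q(\mathbf s,\mathbf a)}{p^{\tilde\pi}(\mathbf s,\mathbf a)}+\log\tilde\pi(\mathbf a|\mathbf s),$$ using $\tilde\phi$ to estimate the ratio in $r_{\mathrm{lb}}^{\tilde\pi}$. AIRL: starting from an initial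 policy, alternate, with $\tilde\pi$ the current policy, between: (1) a discriminator update, which trains the function $\bar\nu_{\boldsymbol\theta}(\mathbf s,\mathbf a)$ in the discriminator $D(\mathbf s,\mathbf a)=\frac{1}{1+\exp(-\nu(\mathbf s,\mathbf a))}$ with logits $\nu(\mathbf s,\mathbf a)=\bar\nu_{\boldsymbol\theta}(\mathbf s,\mathbf a)-\log\tilde\pi(\mathbf a|\mathbf s)$ by maximizing the (negated) binary cross-entropy objective $\mathrm E_{(\mathbf s,\mathbf a)\sim q}[\log D(\mathbf s,\mathbf a)]+\mathrm E_{(\mathbf s,\mathbf a)\sim p^{\tilde\pi}}[\log(1-D(\mathbf s,\mathbf a))]$; and (2) a policy update, which updates the policy to optimize over $\pi$ the entropy-regularized objective $$J_{\text{AIRL-maxent}}(\pi)=\int_{\mathbf s,\mathbf a}p^\pi(\mathbf s,\mathbf a)\big(\bar\nu_{\boldsymbol\theta}(\mathbf s,\mathbf a)-\log\pi(\mathbf a|\mathbf s)\big)\,d\mathbf s\,d\mathbf a .$$ *)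

(* Defs.v *)
From HB Require Import structures.
From mathcomp Require Import all_boot all_order all_algebra.
From mathcomp Require Import all_classical all_reals all_analysis.

Set Implicit Arguments.
Unset Strict Implicit.
Unset Printing Implicit Defensive.

Import Order.TTheory GRing.Theory Num.Theory.
Import numFieldNormedType.Exports.

Local Open Scope classical_set_scope.
Local Open Scope ring_scope.

(* All distributions are given by densities with respect to sigma-finite
   reference measures (Lebesgue measure for continuous spaces, counting measure
   for discrete ones); these measures are the "ds", "da" of the integrals.
   [expR] and [ln] are total functions on R, with [ln x = 0] for [x <= 0]. *)

Section Densities.
Context d (T : measurableType d) (R : realType).
Variable mu : {measure set T -> \bar R}.

Record is_density (f : T -> R) : Prop := IsDensity {
  density_measurable : measurable_fun setT f ;
  density_ge0 : forall x, 0 <= f x ;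
  density_int1 : (\int[mu]_x (f x)%:E = 1)%E }.

Definition density_ratio (q p : T -> R) (x : T) : R := q x / p x.

(* Almost everywhere where the quotient [q / p] is not of the form [0 / 0].
   As [_ / 0 = 0] in R, a positive [phi] satisfying this has [p > 0] a.e. where
   [q > 0]. *)
Definition eq_density_ratio (q p phi : T -> R) : Prop :=
  {ae mu, forall x, 0 < q x + p x -> phi x = density_ratio q p x}.

Definition positive_measurable (phi : T -> R) : Prop :=
  measurable_fun setT phi /\ (forall x, 0 < phi x).

(* A function of two densities and of a candidate ratio whose maximization
   identifies the true density ratio. *)
Definition ratio_consistent
    (L : (T -> R) -> (T -> R) -> (T -> R) -> \bar R) : Prop :=
  forall q p phi, is_density q -> is_density p -> positive_measurable phi ->
    (forall phi', positive_measurable phi' -> (L q p phi' <= L q p phi)%E) ->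
    eq_density_ratio q p phi.

Definition bce (q p D : T -> R) : \bar R :=
  (\int[mu]_x (q x * ln (D x))%:E + \int[mu]_x (p x * ln (1 - D x))%:E)%E.

Definition is_discriminator (D : T -> R) : Prop :=
  measurable_fun setT D /\ (forall x, 0 < D x < 1).

Definition optimal_discriminator (q p D : T -> R) : Prop :=
  is_discriminator D /\
  (forall D', is_discriminator D' -> (bce q p D' <= bce q p D)%E).

Definition discriminator_of_logits (nu : T -> R) (x : T) : R :=
  1 / (1 + expR (- nu x)).

End Densities.

(* An optimization routine: [opt_run J x y] holds when [y] is a possible output
   for the objective [J] and the current iterate [x]. The output is not required
   to be a maximizer, only not to be worse than [x]. *)
Record optimizer (R : realType) (X : Type) := Optimizer {
  opt_run :> (X -> \bar R) -> X -> X -> Prop ;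
  opt_improves : forall J x y, opt_run J x y -> (J x <= J y)%E }.

Section MDP.
Context dS dA (S : measurableType dS) (A : measurableType dA) (R : realType).
Variables (muS : {sigma_finite_measure set S -> \bar R})
          (muA : {sigma_finite_measure set A -> \bar R}).

(* [transition (s, a, s')] is p(s'|s,a). *)
Record mdp := Mdp {
  init : S -> R ;
  transition : (S * A) * S -> R ;
  discount : R ;
  init_density : is_density muS init ;
  transition_measurable : measurable_fun setT transition ;
  transition_density :
    forall x, is_density muS (fun s' => transition (x, s')) ;
  discount_bounds : 0 <= discount < 1 }.

(* [pi (s, a)] is the conditional density pi(a|s). *)
Record policy := Policy {
  policy_pdf :> S * A -> R ;
  policy_measurable : measurable_fun setT policy_pdf ;
  policy_density : forall s, is_density muA (fun a => policy_pdf (s, a)) }.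

Definition muSA := (muS \x muA)%E.

Fixpoint occupancy_at (M : mdp) (pi : policy) (t : nat) (x : S * A) : \bar R :=
  match t with
  | 0%N => (init M x.1 * pi x)%:E
  | t'.+1 => (\int[muSA]_y (occupancy_at M pi t' y * (transition M (y, x.1))%:E)
              * (pi x)%:E)%E
  end.

(* The series is finite almost everywhere; [fine] only changes the density
   on the null set where it is infinite. *)
Definition occupancy (M : mdp) (pi : policy) (x : S * A) : R :=
  fine ((1 - discount M)%:E *
        \sum_(0 <= t <oo) ((discount M ^+ t)%:E * occupancy_at M pi t x))%E.

Definition maxent_objective (M : mdp) (r : S * A -> R) (pi : policy) : \bar R :=
  (\int[muSA]_x (occupancy M pi x * (r x - ln (pi x)))%:E)%E.

(* [r_lb] and [J_NAIL] with an arbitrary function [phi] in the place of the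
   density ratio; the exact ones have
   [phi := density_ratio q (occupancy M pi_cur)]. *)
Definition nail_reward (pi_cur : policy) (phi : S * A -> R) (x : S * A) : R :=
  ln (phi x) + ln (pi_cur x).

Definition nail_objective (M : mdp) (pi_cur : policy) (phi : S * A -> R) :
    policy -> \bar R :=
  maxent_objective M (nail_reward pi_cur phi).

Definition airl_objective (M : mdp) (nubar : S * A -> R) : policy -> \bar R :=
  maxent_objective M nubar.

(* Where [pi_cur] vanishes, [log pi_cur] is not defined and the value [nubar x]
   is a convention; [occupancy M pi_cur] vanishes there as well. *)
Definition airl_logits (pi_cur : policy) (nubar : S * A -> R) (x : S * A) : R :=
  nubar x - ln (pi_cur x).

Definition airl_ratio (pi_cur : policy) (nubar : S * A -> R) (x : S * A) : R :=
  expR (airl_logits pi_cur nubar x).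

Definition airl_discriminator (pi_cur : policy) (nubar : S * A -> R) :
    S * A -> R :=
  discriminator_of_logits (airl_logits pi_cur nubar).

(* A density-ratio estimation procedure: a parametric model of the ratio
   (which may depend on the current policy), trained by maximizing a criterion
   that depends on the two densities and on the model, and that is maximized by
   the true ratio only. *)
Record ratio_estimator (Theta : Type) := RatioEstimator {
  re_model : policy -> Theta -> S * A -> R ;
  re_criterion : (S * A -> R) -> (S * A -> R) -> (S * A -> R) -> \bar R ;
  re_train : optimizer R Theta ;
  re_model_positive :
    forall pi theta, positive_measurable (re_model pi theta) ;
  re_consistent : ratio_consistent muSA re_criterion }.

(* One iteration, from parameters [theta] and policy [pi] to [theta'], [pi'];
   the policy improvement uses the newly computed estimate of the ratio. *)
Definition nail_step (M : mdp) (q : S * A -> R) (Theta : Type)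
    (E : ratio_estimator Theta) (improve : optimizer R policy)
    (theta : Theta) (pi : policy) (theta' : Theta) (pi' : policy) : Prop :=
  re_train E (fun t => re_criterion E q (occupancy M pi) (re_model E pi t))
    theta theta' /\
  improve (nail_objective M pi (re_model E pi theta')) pi pi'.

Definition airl_step (M : mdp) (q : S * A -> R) (Theta : Type)
    (nubar : Theta -> S * A -> R) (train : optimizer R Theta)
    (improve : optimizer R policy)
    (theta : Theta) (pi : policy) (theta' : Theta) (pi' : policy) : Prop :=
  train (fun t => bce muSA q (occupancy M pi) (airl_discriminator pi (nubar t)))
    theta theta' /\
  improve (airl_objective M (nubar theta')) pi pi'.

End MDP.

(* Main.v *)
(* For fixed nonnegative numbers [q] and [p], not both zero, the map
   [D |-> q ln D + p ln (1 - D)] is strictly concave on (0, 1), with maximizer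
   [q / (q + p)]. Moving an optimal discriminator halfway towards this value
   therefore cannot decrease the cross-entropy objective, and leaves it equal
   only if [D = q / (q + p)] almost everywhere where [q + p > 0]; as the logits
   satisfy [exp nu = D / (1 - D)], this is [exp nu = q / p]. A positive function
   [phi] is the same thing as a discriminator with logits [ln phi], so
   cross-entropy is a consistent criterion for the ratio [phi]. *)
Require Import Defs.
From HB Require Import structures.
From mathcomp Require Import all_boot all_order all_algebra.
From mathcomp Require Import all_classical all_reals all_analysis.
From mathcomp Require Import measurable_realfun ring lra.

Set Implicit Arguments.
Unset Strict Implicit.
Unset Printing Implicit Defensive.

Import Order.TTheory GRing.Theory Num.Theory.
Import numFieldNormedType.Exports.

Local Open Scope classical_set_scope.
Local Open Scope ring_scope.

(** * Elementary inequalities for the logarithm *)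

Lemma ln_ge_subV (R : realType) (x : R) : 0 < x -> 1 - x^-1 <= ln x.
Proof.
move=> x0; have xV0 : 0 < x^-1 by rewrite invr_gt0.
have := @le_ln1Dx R (x^-1 - 1); rewrite subrKC lnV ?posrE//.
by rewrite ltrBrDl subrr => /(_ xV0); lra.
Qed.

(** [ln_ge_subV] at [D' / D] and [(1 - D') / (1 - D)] bounds both logarithmic increments from below.
    Weighted by [q] and [p], the bounds sum to [(q + p) * (m - D) ^+ 2 / (4 * (D' * (1 - D')))],
    whose denominator is at most 1. Defining [m] by [q = (q + p) * m] admits [q = p = 0]. *)
Lemma bce_pointwise_gain (R : realType) (q p m D : R) :
  0 <= q -> 0 <= p -> 0 < D < 1 -> 0 <= m <= 1 -> q = (q + p) * m ->
  let D' := (D + m) / 2 in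
  q * ln D + p * ln (1 - D) + (q + p) * (m - D) ^+ 2 <=
  q * ln D' + p * ln (1 - D').
Proof.
move=> q0 p0 /andP[D0 D1] /andP[m0 m1] qE /=; set D' := (D + m) / 2.
have D'E : D + m = D' * 2 by rewrite /D' -mulrA mulVf ?mulr1.
clearbody D'.
have D'0 : 0 < D' by lra.
have D'1 : 0 < 1 - D' by lra.
have lnD : 1 - D / D' <= ln D' - ln D.
  rewrite -ln_div ?posrE// -[D / D']invf_div.
  by apply: ln_ge_subV; rewrite divr_gt0.
have D1' : 0 < 1 - D by lra.
have ln1D : 1 - (1 - D) / (1 - D') <= ln (1 - D') - ln (1 - D).
  rewrite -ln_div ?posrE// -[(1 - D) / (1 - D')]invf_div.
  by apply: ln_ge_subV; rewrite divr_gt0.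
have qle := ler_wpM2l q0 lnD; have ple := ler_wpM2l p0 ln1D.
have gainE : q * (1 - D / D') + p * (1 - (1 - D) / (1 - D')) =
    (q + p) * (m - D) ^+ 2 / (4 * (D' * (1 - D'))).
  have -> : p = (q + p) * (1 - m) by lra.
  have -> : q * (1 - D / D') = (q + p) * m * (1 - D / D') by rewrite -qE.
  have -> : q + (q + p) * (1 - m) = q + p by lra.
  have -> : m = D' * 2 - D by lra.
  by field; rewrite !gt_eqF.
have gain_ge : (q + p) * (m - D) ^+ 2 <=
    (q + p) * (m - D) ^+ 2 / (4 * (D' * (1 - D'))).
  rewrite ler_pdivlMr ?mulr_gt0//; apply: ler_piMr.
    by rewrite mulr_ge0 ?addr_ge0 ?sqr_ge0.
  (* The denominator equals [1 - (2 * D' - 1) ^+ 2]. *)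
  have := sqr_ge0 (2 * D' - 1); nra.
nra.
Qed.

(** * Cross-entropy and optimal discriminators *)

Section Discriminator.
Context d (T : measurableType d) (R : realType).
Variable mu : {measure set T -> \bar R}.
Implicit Types q p D nu : T -> R.

(** The sign makes this nonnegative for densities and a discriminator, so that integrals can be
    added and compared without integrability assumptions. *)
Definition bce_loss q p D (x : T) : R :=
  - (q x * ln (D x) + p x * ln (1 - D x)).

Lemma measurable_bce_loss q p D : measurable_fun setT q ->
  measurable_fun setT p -> measurable_fun setT D ->
  measurable_fun setT (bce_loss q p D).
Proof.
move=> mq mp mD; apply: measurable_funN; apply: measurable_funD.
  by apply: measurable_funM => //; apply: measurableT_comp.
apply: measurable_funM => //; apply: measurableT_comp => //.
exact: measurable_funB.
Qed.

Lemma ln_discriminator_le0 D : is_discriminator D ->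
  forall x, ln (D x) <= 0 /\ ln (1 - D x) <= 0.
Proof.
by move=> [_ D01] x; have /andP[D0 D1] := D01 x; split; apply: ln_le0; lra.
Qed.

Lemma bce_loss_ge0 q p D : (forall x, 0 <= q x) -> (forall x, 0 <= p x) ->
  is_discriminator D -> forall x, 0 <= bce_loss q p D x.
Proof.
move=> q0 p0 Dd x; have [l1 l2] := ln_discriminator_le0 Dd x.
by rewrite oppr_ge0 -[leRHS]addr0 lerD// mulr_ge0_le0.
Qed.

Lemma bceE q p D : is_density mu q -> is_density mu p -> is_discriminator D ->
  bce mu q p D = (- \int[mu]_x (bce_loss q p D x)%:E)%E.
Proof.
move=> [mq q0 _] [mp p0 _] Dd; have [mD _] := Dd.
have l0 := ln_discriminator_le0 Dd.
have neg_ge0 (f g : T -> R) : (forall x, 0 <= f x) -> (forall x, g x <= 0) ->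
    forall x, setT x -> (0 <= (f x * - g x)%:E)%E.
  by move=> f0 g0 x _; rewrite lee_fin mulr_ge0// oppr_ge0.
have m_neg (f g : T -> R) : measurable_fun setT f -> measurable_fun setT g ->
    measurable_fun setT (fun x => (f x * - ln (g x))%:E).
  move=> mf mg; apply/measurable_EFinP; apply: measurable_funM => //.
  by apply: measurable_funN; apply: measurableT_comp.
have q_neg := neg_ge0 q (fun x => ln (D x)) q0 (fun x => (l0 x).1).
have p_neg := neg_ge0 p (fun x => ln (1 - D x)) p0 (fun x => (l0 x).2).
have intN (f g : T -> R) : (forall x, setT x -> (0 <= (f x * - g x)%:E)%E) ->
    (\int[mu]_x (f x * g x)%:E = - \int[mu]_x (f x * - g x)%:E)%E.
  move=> fg0; rewrite -integral_ge0N//.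
  by apply: eq_integral => x _; rewrite -EFinN mulrN opprK.
rewrite /bce (intN _ _ q_neg) (intN _ _ p_neg).
rewrite -oppeD ?ge0_adde_def ?inE ?integral_ge0//.
rewrite -ge0_integralD//; [|exact: m_neg|]; last first.
  by apply: m_neg => //; exact: measurable_funB.
congr (- _)%E; apply: eq_integral => x _.
by rewrite -EFinD /bce_loss opprD !mulrN.
Qed.

(** The constant discriminator 1/2 has loss [2 ln 2], because [q] and [p] have mass 1, and an
    optimal one does no worse. Finiteness is needed to cancel losses below. *)
Lemma optimal_bce_loss_lty q p D : is_density mu q -> is_density mu p ->
  optimal_discriminator mu q p D ->
  (\int[mu]_x (bce_loss q p D x)%:E < +oo)%E.
Proof.
move=> dq dp [Dd Dopt]; have [mq q0 q1] := dq; have [mp p0 p1] := dp.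
have half_d : is_discriminator (cst 2^-1 : T -> R).
  by split => // x /=; rewrite invr_gt0 invf_lt1// ltr1n ltr0n.
have := Dopt _ half_d; rewrite !bceE// leeN2 => /le_lt_trans; apply.
have c0 : 0 <= - ln (2^-1 : R) by rewrite oppr_ge0 ln_le0// invf_le1// ler1n.
set c := - ln _ in c0.
have lossE x :
    (bce_loss q p (cst 2^-1) x)%:E = (c%:E * (q x)%:E + c%:E * (p x)%:E)%E.
  rewrite -!EFinM -EFinD /bce_loss /=; have -> : 1 - 2^-1 = 2^-1 :> R by field.
  by rewrite /c; congr _%:E; ring.
under eq_integral do rewrite lossE.
rewrite ge0_integralD//.
- rewrite !ge0_integralZl//; try exact/measurable_EFinP.
  + by rewrite q1 p1 !mule1 -EFinD ltry.
  + by move=> x _; rewrite lee_fin.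
  + by move=> x _; rewrite lee_fin.
- by move=> x _; rewrite mule_ge0// lee_fin.
- by apply: emeasurable_funM => //; exact/measurable_EFinP.
- by move=> x _; rewrite mule_ge0// lee_fin.
- by apply: emeasurable_funM => //; exact/measurable_EFinP.
Qed.

(* The competitor is [(D + q / (q + p)) / 2]; [q / (q + p)] itself may take the
   values 0 and 1, which a discriminator does not. *)
Lemma optimal_discriminator_ae q p D : is_density mu q -> is_density mu p ->
  optimal_discriminator mu q p D ->
  {ae mu, forall x, q x * (1 - D x) = p x * D x}.
Proof.
move=> dq dp Dopt; have [mq q0 _] := dq; have [mp p0 _] := dp.
have lossD_lty := optimal_bce_loss_lty dq dp Dopt.
case: Dopt => Dd Dopt; have [mD D01] := Dd.
(* [q / (q + p)], in a form whose measurability is immediate *)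
pose m x := q x * expR (- ln (q x + p x)).
have mm : measurable_fun setT m.
  apply: measurable_funM => //; apply: measurableT_comp => //.
  apply: measurable_funN; apply: measurableT_comp => //.
  exact: measurable_funD.
have qE x : q x = (q x + p x) * m x.
  have [s0|s0] := ltP 0 (q x + p x).
    by rewrite /m expRN lnK ?posrE// mulrCA mulfV ?mulr1 ?gt_eqF.
  have qx0 : q x = 0 by have := q0 x; have := p0 x; lra.
  by rewrite /m qx0 mul0r mulr0.
have m01 x : 0 <= m x <= 1.
  rewrite mulr_ge0 ?expR_ge0//=.
  have [s0|s0] := ltP 0 (q x + p x).
    by rewrite /m expRN lnK ?posrE// ler_pdivrMr// mul1r lerDl.
  have qx0 : q x = 0 by have := q0 x; have := p0 x; lra.
  by rewrite /m qx0 mul0r ler01.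
pose D' x := (D x + m x) / 2.
have mD' : measurable_fun setT D'.
  by apply: measurable_funM => //; exact: measurable_funD.
have D'd : is_discriminator D'.
  split=> // x; rewrite /D'; have := D01 x; have := m01 x.
  move=> /andP[? ?] /andP[? ?]; apply/andP; split; lra.
pose h x := (q x + p x) * (m x - D x) ^+ 2.
have mh : measurable_fun setT h.
  apply: measurable_funM; first exact: measurable_funD.
  by apply: measurable_funX; exact: measurable_funB.
have h0 x : 0 <= h x by rewrite mulr_ge0 ?addr_ge0 ?sqr_ge0.
have mloss E : is_discriminator E ->
    measurable_fun setT (EFin \o bce_loss q p E).
  by move=> [mE _]; apply/measurable_EFinP; exact: measurable_bce_loss.
have gain : (\int[mu]_x (bce_loss q p D' x)%:E + \int[mu]_x (h x)%:E <=
             \int[mu]_x (bce_loss q p D x)%:E)%E.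
  rewrite -ge0_integralD//; last 4 first.
  - by move=> x _; rewrite lee_fin bce_loss_ge0.
  - exact: mloss.
  - by move=> x _; rewrite lee_fin.
  - exact/measurable_EFinP.
  apply: ge0_le_integral => //.
  - by move=> x _; rewrite -EFinD lee_fin addr_ge0// bce_loss_ge0.
  - by apply: emeasurable_funD; [exact: mloss|exact/measurable_EFinP].
  - exact: mloss.
  - move=> x _; rewrite -EFinD lee_fin /bce_loss /h.
    have := bce_pointwise_gain (q0 x) (p0 x) (D01 x) (m01 x) (qE x).
    by rewrite /= -/(D' x); lra.
(* Optimality and [gain] give loss(D') + int h <= loss(D) <= loss(D'). The loss of [D'] is finite
   and cancels, so [h] has integral 0 and vanishes almost everywhere. *)
have := Dopt _ D'd; rewrite !bceE// leeN2 => lossD_le.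
have lossD'_fin : (\int[mu]_x (bce_loss q p D' x)%:E)%E \is a fin_num.
  rewrite ge0_fin_numE; last first.
    by apply: integral_ge0 => x _; rewrite lee_fin bce_loss_ge0.
  apply: le_lt_trans lossD_lty; apply: le_trans gain.
  by rewrite leeDl// integral_ge0// => x _; rewrite lee_fin.
have inth0 : (\int[mu]_x `|(h x)%:E| = 0)%E.
  apply/eqP; rewrite eq_le integral_ge0// andbT.
  under eq_integral do rewrite gee0_abs ?lee_fin//.
  by rewrite -(leeD2lE _ 0%E lossD'_fin) adde0; exact: le_trans gain lossD_le.
have /measurable_EFinP mEh := mh.
have := (ae_eq_integral_abs mu measurableT mEh).1 inth0.
apply: filterS => x /(_ I) /= [] /eqP; rewrite mulf_eq0 sqrf_eq0 subr_eq0.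
move=> /orP[/eqP s0|/eqP mDx].
  have [-> ->] : q x = 0 /\ p x = 0 by have := q0 x; have := p0 x; lra.
  by rewrite !mul0r.
by have := qE x; rewrite mDx; lra.
Qed.

(** With [e = expR (- nu x)], the equation [q (1 - D) = p D] becomes [p = q e]. Then [q = 0] would
    force [p = 0], against [0 < q + p]; so [q / p] is a genuine quotient, equal to [1 / e]. *)
Lemma optimal_logits_density_ratio q p nu :
  is_density mu q -> is_density mu p ->
  optimal_discriminator mu q p (discriminator_of_logits nu) ->
  eq_density_ratio mu q p (@expR R \o nu).
Proof.
move=> dq dp Dopt; have := optimal_discriminator_ae dq dp Dopt.
apply: filterS => x; rewrite /discriminator_of_logits /density_ratio /=.
have e0 := expR_gt0 (- nu x); have -> : expR (nu x) = (expR (- nu x))^-1.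
  by rewrite expRN invrK.
move: (expR _) e0 => e e0 qp s0.
have e1 : 1 + e != 0 by rewrite gt_eqF// addr_gt0.
have pE : p x = q x * e.
  apply: (@mulIf _ (1 / (1 + e))).
    by rewrite mulf_neq0 ?invr_eq0 ?oner_eq0.
  by rewrite -qp; field.
have qx0 : q x != 0.
  by apply/eqP => qx0; move: s0; rewrite pE qx0 mul0r addr0 ltxx.
by rewrite pE; field; rewrite gt_eqF.
Qed.

Lemma discriminator_of_logitsP nu : measurable_fun setT nu ->
  is_discriminator (discriminator_of_logits nu).
Proof.
move=> mnu; split=> [|x]; last first.
  have e0 := expR_gt0 (- nu x).
  rewrite /discriminator_of_logits divr_gt0 ?addr_gt0//=.
  by rewrite ltr_pdivrMr ?addr_gt0// mul1r ltrDl.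
(* As the exponential of a negated logarithm, the reciprocal is measurable by composition. *)
rewrite (_ : discriminator_of_logits nu =
  fun x => expR (- ln (1 + expR (- nu x)))); last first.
  apply/funext => x; rewrite /discriminator_of_logits.
  rewrite [expR (- ln _)]expRN lnK ?div1r//.
  by rewrite posrE addr_gt0 ?expR_gt0.
apply: measurableT_comp => //; apply: measurable_funN.
apply: measurableT_comp => //; apply: measurable_funD => //.
by apply: measurableT_comp => //; exact: measurable_funN.
Qed.

(** The logit inverts the logistic function. Hence every discriminator comes from a positive ratio
    [D / (1 - D)], and optimality among ratios is optimality among all discriminators. *)
Lemma discriminator_of_logitsK D : is_discriminator D ->
  discriminator_of_logits (fun x => ln (D x) - ln (1 - D x)) = D.
Proof.
move=> [_ D01]; apply/funext => x; have /andP[D0 D1] := D01 x.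
rewrite /discriminator_of_logits opprB expRD expRN !lnK ?posrE ?subr_gt0//.
by field; rewrite subrKC oner_eq0 gt_eqF.
Qed.

(** For positive [phi] the discriminator used here is [phi / (1 + phi)]. *)
Definition bce_ratio_criterion q p phi : \bar R :=
  bce mu q p (discriminator_of_logits (@ln R \o phi)).

Lemma bce_ratio_consistent : ratio_consistent mu bce_ratio_criterion.
Proof.
move=> q p phi dq dp [mphi phi0] phi_opt.
have -> : phi = @expR R \o (@ln R \o phi).
  by apply/funext => x /=; rewrite lnK// posrE.
apply: optimal_logits_density_ratio => //; split.
  by apply: discriminator_of_logitsP; exact: measurableT_comp.
move=> D Dd; have [mD D01] := Dd.
pose nu x := ln (D x) - ln (1 - D x).
have := phi_opt (@expR R \o nu).
rewrite /bce_ratio_criterion (_ : @ln R \o (@expR R \o nu) = nu); last first.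
  by apply/funext => x /=; rewrite expRK.
rewrite discriminator_of_logitsK//; apply; split=> [|x]; last exact: expR_gt0.
apply: measurableT_comp => //; apply: measurable_funB.
  exact: measurableT_comp.
by apply: measurableT_comp => //; exact: measurable_funB.
Qed.

End Discriminator.

(** * Geometric series and sigma-finite products *)

Lemma nneseries_geometric (R : realType) (z : R) : 0 <= z < 1 ->
  (\sum_(0 <= t <oo) (z ^+ t)%:E = ((1 - z)^-1)%:E)%E.
Proof.
move=> /andP[z0 z1]; apply/cvg_lim => //.
rewrite (_ : (fun n => _) = EFin \o series (geometric 1 z)); last first.
  apply/funext => n /=; rewrite sumEFin; congr _%:E.
  by apply: eq_bigr => i _ /=; rewrite mul1r.
rewrite -[(1 - z)^-1]mul1r; apply: cvg_EFin; first exact: nearW.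
by apply: cvg_geometric_series; rewrite ger0_norm.
Qed.

Section ProductSigmaFinite.
Context d1 d2 (T1 : measurableType d1) (T2 : measurableType d2) (R : realType).
Variable m1 : {sigma_finite_measure set T1 -> \bar R}.
Variable m2 : {sigma_finite_measure set T2 -> \bar R}.

(** Rectangles built from two exhausting sequences suffice: since both sequences increase, a point
    of [F i] times [G j] lies in the rectangle of index [maxn i j]. *)
Lemma product_measure1_sigma_finite : sigma_finite setT (m1 \x m2)%E.
Proof.
have /sigma_finiteP[F [TF ndF Foo]] := sigma_finiteT m1.
have /sigma_finiteP[G [TG ndG Goo]] := sigma_finiteT m2.
exists (fun n => F n `*` G n) => [|k].
  rewrite -setXTT TF TG; apply/seteqP; split => -[x y].
    move=> [[i _ Fx] [j _ Gy]]; exists (maxn i j) => //; split.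
      by apply: (subsetPset _ _ (ndF _ _ (leq_maxl i j))).
    by apply: (subsetPset _ _ (ndG _ _ (leq_maxr i j))).
  by move=> [i _ [Fx Gy]]; split; exists i.
have [mF Fk] := Foo k; have [mG Gk] := Goo k.
split; first exact: measurableX.
by rewrite product_measure1E// lte_mul_pinfty// ge0_fin_numE.
Qed.

(* The canonical sigma-finite structure on [m1 \x m2] found by unification is that
   of a product of subprobabilities. *)
Definition sigma_finite_product :
    {sigma_finite_measure set (T1 * T2)%type -> \bar R} :=
  HB.pack (m1 \x m2)%E (Measure_isSigmaFinite.Build _ _ _ (m1 \x m2)%E
    product_measure1_sigma_finite).
End ProductSigmaFinite.

(** * The discounted occupancy is a probability density *)

Section Occupancy.
Context dS dA (S : measurableType dS) (A : measurableType dA) (R : realType).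
Variables (muS : {sigma_finite_measure set S -> \bar R})
          (muA : {sigma_finite_measure set A -> \bar R}).
Variables (M : mdp A muS) (pi : policy S muA).

Let muSxA := sigma_finite_product muS muA.

(** By Tonelli the action is integrated out first, and [pi(.|s)] has mass 1. *)
Lemma policy_integral_joint (F : S -> \bar R) :
  measurable_fun setT F -> (forall s, 0 <= F s)%E ->
  (\int[muSA muS muA]_x (F x.1 * (pi x)%:E) = \int[muS]_s F s)%E.
Proof.
move=> mF F0; have mpi := policy_measurable pi.
have pi0 x : 0 <= pi x.
  by case: x => s a; have := density_ge0 (policy_density pi s) a.
rewrite /muSA fubini_tonelli1/=; last 2 first.
- apply: emeasurable_funM; last exact/measurable_EFinP.
  exact: (measurableT_comp mF).
- by move=> x; rewrite mule_ge0// lee_fin.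
apply: eq_integral => s _; rewrite /fubini_F /= ge0_integralZl//.
- by rewrite density_int1 ?mule1//; exact: policy_density.
- by apply/measurable_EFinP; exact: measurable_fun_pair2.
- by move=> a _; rewrite lee_fin.
Qed.

Let transition_ge0 x : 0 <= transition M x.
Proof. by case: x => x s'; have := density_ge0 (transition_density M x) s'. Qed.

(** Induction on time: [f] is the joint density of the current pair and the next state, and its
    marginal on the next state is measurable by Tonelli. [is_density] does not apply, the values
    being extended reals. *)
Lemma occupancy_at_density t :
  [/\ measurable_fun setT (occupancy_at M pi t),
      forall x, (0 <= occupancy_at M pi t x)%E &
      (\int[muSA muS muA]_x occupancy_at M pi t x = 1)%E].
Proof.
have [minit init0 init1] := init_density M.
have mpi := policy_measurable pi.
have pi0 x : 0 <= pi x.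
  by case: x => s a; have := density_ge0 (policy_density pi s) a.
elim: t => [|t [mt t0 t1]] /=.
  split.
  - apply/measurable_EFinP; apply: measurable_funM => //.
    exact: (measurableT_comp minit).
  - by move=> x; rewrite lee_fin mulr_ge0.
  - under eq_integral do rewrite EFinM.
    rewrite (policy_integral_joint (F := EFin \o init M))//.
    exact/measurable_EFinP.
pose f (z : (S * A) * S) := (occupancy_at M pi t z.1 * (transition M z)%:E)%E.
have mf : measurable_fun setT f.
  apply: emeasurable_funM; first exact: (measurableT_comp mt).
  by apply/measurable_EFinP; exact: transition_measurable.
have f0 z : (0 <= f z)%E by rewrite mule_ge0// lee_fin.
have mF := @measurable_fun_fubini_tonelli_G _ _ _ _ _ muSxA f mf f0.
have F0 s : (0 <= fubini_G muSxA f s)%E by apply: integral_ge0.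
(* [muSA] and [muSxA] agree by conversion; the latter carries the sigma-finite structure used for
   Tonelli. *)
have FE x :
    (\int[muSA muS muA]_y (occupancy_at M pi t y * (transition M (y, x.1))%:E) =
    fubini_G muSxA f x.1)%E by [].
split.
- apply: emeasurable_funM; last exact/measurable_EFinP.
  exact: (measurableT_comp mF).
- by move=> x; rewrite mule_ge0 ?lee_fin// FE.
(* After exchanging the integrals, the next state is integrated out first, with mass 1, leaving the
   mass at time [t]. *)
- under eq_integral do rewrite FE.
  rewrite policy_integral_joint// -(@fubini_tonelli _ _ _ _ _ muSxA muS f)//.
  rewrite -[RHS]t1; apply: eq_integral => x _; rewrite /f /=.
  rewrite ge0_integralZl//.
  + by rewrite density_int1 ?mule1//; exact: transition_density.
  + apply/measurable_EFinP.
    exact: (measurable_fun_pair2 _ (transition_measurable M)).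
  + by move=> s _; rewrite lee_fin.
Qed.

(** The weights [(1 - g) * g ^+ t] sum to 1, so the extended-real density [F] has mass 1. It is
    therefore finite almost everywhere, and [fine] preserves its integral. *)
Lemma occupancy_density : is_density (muSA muS muA) (occupancy M pi).
Proof.
have /andP[g0 g1] := discount_bounds M.
set g := discount M in g0 g1.
pose F x :=
  ((1 - g)%:E * \sum_(0 <= t <oo) ((g ^+ t)%:E * occupancy_at M pi t x))%E.
have term0 t x : (0 <= (g ^+ t)%:E * occupancy_at M pi t x)%E.
  have [_ o0 _] := occupancy_at_density t.
  by rewrite mule_ge0// lee_fin exprn_ge0.
have mterm t :
    measurable_fun setT (fun x => (g ^+ t)%:E * occupancy_at M pi t x)%E.
  by have [mo _ _] := occupancy_at_density t; exact: emeasurable_funM.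
have msum : measurable_fun setT
    (fun x => \sum_(0 <= t <oo) ((g ^+ t)%:E * occupancy_at M pi t x))%E.
  exact: ge0_emeasurable_sum.
have mF : measurable_fun setT F by exact: emeasurable_funM.
have sum0 x : (0 <= \sum_(0 <= t <oo) ((g ^+ t)%:E * occupancy_at M pi t x))%E.
  exact: nneseries_ge0.
have F0 x : (0 <= F x)%E by rewrite mule_ge0// lee_fin subr_ge0 ltW.
have F1 : (\int[muSA muS muA]_x F x = 1)%E.
  rewrite ge0_integralZl ?lee_fin ?subr_ge0 ?(ltW g1)//.
  rewrite integral_nneseries//.
  rewrite (eq_eseriesr (g := fun t => (g ^+ t)%:E)); last first.
    move=> t _; have [mo o0 o1] := occupancy_at_density t.
    by rewrite ge0_integralZl ?lee_fin ?exprn_ge0// o1 mule1.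
  by rewrite nneseries_geometric ?g0// -EFinM mulfV// gt_eqF// subr_gt0.
have oE x : occupancy M pi x = fine (F x) by [].
split.
- exact: (measurableT_comp (fine_measurable _)).
- by move=> x; rewrite oE fine_ge0.
- rewrite -[RHS]F1; apply: ge0_ae_eq_integral => //.
  + apply/measurable_EFinP; exact: (measurableT_comp (fine_measurable _)).
  + by move=> x _; rewrite lee_fin oE fine_ge0.
  have Fint : (muSA muS muA).-integrable setT F.
    apply/integrableP; split => //.
    under eq_integral do rewrite gee0_abs//.
    by rewrite F1 ltry.
  have := integrable_ae measurableT Fint.
  by apply: filterS => x /(_ I) Fx _; rewrite oE fineK.
Qed.

End Occupancy.

(** * AIRL steps as NAIL steps *)

Theorem corollary1 (R : realType) (dS dA : measure_display)
    (S : measurableType dS) (A : measurableType dA)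
    (muS : {sigma_finite_measure set S -> \bar R})
    (muA : {sigma_finite_measure set A -> \bar R})
    (M : mdp A muS)
    (q : S * A -> R) (hq : is_density (muSA muS muA) q)
    (Theta : Type) (nubar : Theta -> S * A -> R)
    (hnubar : forall theta, measurable_fun setT (nubar theta))
    (train : optimizer R Theta) (improve : optimizer R (policy S muA)) :
  (exists E : ratio_estimator muS muA Theta,
     [/\ re_train E = train,
         (forall (pi : policy S muA) (theta : Theta),
            re_model E pi theta = airl_ratio pi (nubar theta)),
         (forall (p : S * A -> R) (pi : policy S muA) (theta : Theta),
            re_criterion E q p (airl_ratio pi (nubar theta)) =
            bce (muSA muS muA) q p (airl_discriminator pi (nubar theta))) &
         (forall (theta theta' : Theta) (pi pi' : policy S muA),
            airl_step M q nubar train improve theta pi theta' pi' <->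
            nail_step M q E improve theta pi theta' pi')])
  /\
  (forall (pi_cur : policy S muA) (theta : Theta),
     [/\ (optimal_discriminator (muSA muS muA) q (occupancy M pi_cur)
            (airl_discriminator pi_cur (nubar theta)) ->
          eq_density_ratio (muSA muS muA) q (occupancy M pi_cur)
            (airl_ratio pi_cur (nubar theta))),
         (forall pi : policy S muA,
            airl_objective M (nubar theta) pi =
            nail_objective M pi_cur (airl_ratio pi_cur (nubar theta)) pi) &
         nail_reward pi_cur (airl_ratio pi_cur (nubar theta)) = nubar theta]).
Proof.
have mlogits (pi : policy S muA) theta :
    measurable_fun setT (airl_logits pi (nubar theta)).
  apply: measurable_funB => //.
  by apply: measurableT_comp => //; exact: policy_measurable.
have ratio_positive (pi : policy S muA) theta :
    positive_measurable (airl_ratio pi (nubar theta)).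
  by split=> [|x]; [exact: measurableT_comp|exact: expR_gt0].
(* This holds even where [pi] vanishes: the default value of [ln (pi x)] is subtracted and added
   back. *)
have rewardE (pi : policy S muA) theta :
    nail_reward pi (airl_ratio pi (nubar theta)) = nubar theta.
  by apply/funext => x; rewrite /nail_reward expRK subrK.
have criterionE p (pi : policy S muA) theta :
    bce_ratio_criterion (muSA muS muA) q p (airl_ratio pi (nubar theta)) =
    bce (muSA muS muA) q p (airl_discriminator pi (nubar theta)).
  rewrite /bce_ratio_criterion; congr bce; congr discriminator_of_logits.
  by apply/funext => x; rewrite /= expRK.
split; last first.
  move=> pi theta; split=> [Dopt|pi'|//].
    exact: optimal_logits_density_ratio hq (occupancy_density M pi) Dopt.
  by rewrite /nail_objective rewardE.
(* The estimator keeps the training routine of AIRL and takes cross-entropy as criterion; [rewardE]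
   and [criterionE] then make the objectives of the two algorithms equal. *)
exists (RatioEstimator train ratio_positive
  (bce_ratio_consistent (mu := muSA muS muA))); split=> //.
move=> theta theta' pi pi'.
rewrite /airl_step /nail_step /nail_objective /= rewardE.
by under [in X in _ <-> X]eq_fun do rewrite criterionE.
Qed.
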